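(* Let $G$ be a tree, and let $G'$ be the graph obtained from $G$ by removing at most $k$ edges (keeping all vertices). Then $$0 \leq meg(G') \leq meg(G) + 2k.$$
   Context: Graphs are finite, undirected and simple. In a connected graph $H$, an edge $e$ is monitored by a pair of vertices $x,y$ if $e$ lies on all shortest paths between $x$ and $y$. A set $M\subseteq V(H)$ is a monitoring edge-geodetic set (MEG-set) of $H$ if every edge of $H$ is monitored by some pair of vertices of $M$; $meg(H)$ is the minimum size of a MEG-set of $H$. For a disconnected graph, a MEG-set is the union of MEG-sets of its connected components, where the MEG-set of an isolated vertex is taken to be empty; so $meg$ is the sum of the $meg$ of the components, an isolated vertex contributing $0$. *)

(* Defs.v *)
From mathcomp Require Import all_boot.

Set Implicit Arguments.
Unset Strict Implicit.
Unset Printing Implicit Defensive.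

Record sgraph := SGraph {
  vertex :> finType;
  adj : rel vertex;
  adj_sym : symmetric adj;
  adj_irrefl : irreflexive adj
}.

Definition edges (G : sgraph) : {set {set G}} :=
  [set [set z.1; z.2] | z : G * G & adj z.1 z.2].

Definition connected (G : sgraph) : Prop :=
  0 < #|G| /\ forall x y : G, connect (@adj G) x y.

(* [:: x; y] is a [ucycle] as soon as x and y are adjacent, hence the bound. *)
Definition acyclic (G : sgraph) : Prop :=
  forall c : seq G, ucycle (@adj G) c -> size c <= 2.

Definition is_tree (G : sgraph) : Prop := connected G /\ acyclic G.

Section DelEdges.
Variables (G : sgraph) (F : {set {set G}}).

Definition del_adj : rel G := [rel x y | adj x y && ([set x; y] \notin F)].

Lemma del_adj_sym : symmetric del_adj.
Proof. by move=> x y; rewrite /del_adj /= adj_sym setUC. Qed.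

Lemma del_adj_irrefl : irreflexive del_adj.
Proof. by move=> x; rewrite /del_adj /= adj_irrefl. Qed.

Definition del_edges : sgraph := SGraph del_adj_sym del_adj_irrefl.
End DelEdges.

Section Induced.
Variables (G : sgraph) (C : {set G}).

Definition induced_adj : rel {x : G | x \in C} :=
  [rel x y | adj (val x) (val y)].

Lemma induced_adj_sym : symmetric induced_adj.
Proof. by move=> x y; exact: adj_sym. Qed.

Lemma induced_adj_irrefl : irreflexive induced_adj.
Proof. by move=> x; exact: adj_irrefl. Qed.

Definition induced : sgraph := SGraph induced_adj_sym induced_adj_irrefl.
End Induced.

Definition components (G : sgraph) : {set {set G}} :=
  [set [set y | connect (@adj G) x y] | x : G].

(* As in [path], a walk starting at x is given by the list p of the vertices  *)
(* that follow x; its length is [size p].                                     *)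
Definition walk (G : sgraph) (x y : G) (p : seq G) : bool :=
  path (@adj G) x p && (last x p == y).

Definition walk_edges (G : sgraph) (x : G) (p : seq G) : seq {set G} :=
  [seq [set z.1; z.2] | z <- zip (x :: p) p].

(* The least length of a walk from x to y; when x and y are connected this is *)
(* less than #|G|. The value is #|G| when they are not.                       *)
Definition dist (G : sgraph) (x y : G) : nat :=
  find (fun n => [exists p : n.-tuple G, walk x y p]) (iota 0 #|G|).

(* The shortest paths from x to y are the walks of length [dist x y].         *)
Definition monitored (G : sgraph) (e : {set G}) (x y : G) : bool :=
  [forall p : (dist x y).-tuple G, walk x y p ==> (e \in walk_edges x p)].

(* Only meant for a connected G. *)
Definition connected_meg_set (G : sgraph) (M : {set G}) : bool :=
  [forall e in edges G, [exists x in M, [exists y in M, monitored e x y]]].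

(* The components being disjoint, M is a union of MEG-sets of the components  *)
(* iff its trace on each component is a MEG-set of that component; on an      *)
(* isolated vertex that MEG-set is empty by convention.                       *)
Definition meg_set (G : sgraph) (M : {set G}) : bool :=
  [forall C in components G,
     if #|C| == 1 then M :&: C == set0
     else @connected_meg_set (induced C) [set x | val x \in M]].

Lemma adj_monitored (G : sgraph) (x y : G) :
  adj x y -> monitored [set x; y] x y.
Proof.
move=> xy; have nxy : x != y by apply: contraTneq xy => ->; rewrite adj_irrefl.
have c2 : 1 < #|G|.
  by have := max_card (mem [set x; y]); rewrite cards2 nxy.
have d1 : dist x y = 1.
  rewrite /dist; case: #|G| c2 => [|[|n]] //= _.
  case: existsP => [[p /andP[_ /eqP]]|_].
    by rewrite (tuple0 p) /= => E; rewrite E eqxx in nxy.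
  by case: existsP => // -[]; exists [tuple y]; rewrite /walk /= xy eqxx.
apply/forallP; rewrite d1 => p; apply/implyP.
case/tupleP: p => z p; rewrite (tuple0 p) /walk /walk_edges /= => /andP[_ /eqP->].
by rewrite inE.
Qed.

Lemma meg_set_ex (G : sgraph) :
  exists n, [exists M : {set G}, meg_set M && (#|M| == n)].
Proof.
pose M := [set x : G | [exists y, adj x y]].
exists #|M|; apply/existsP; exists M; rewrite eqxx andbT.
apply/forall_inP => C /imsetP[x0 _ defC].
case: ifP => [/cards1P[z Cz]|_].
  rewrite Cz; apply/eqP/setP => x; rewrite !inE.
  apply/negP => /andP[/existsP[y xy] /eqP xz].
  have x0x : connect (@adj G) x0 x.
    have : x \in C by rewrite Cz xz inE.
    by rewrite defC inE.
  have : y \in C by rewrite defC inE (connect_trans x0x) ?connect1.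
  by rewrite Cz inE -xz => /eqP E; rewrite E adj_irrefl in xy.
apply/forall_inP => e /imsetP[[x y]]; rewrite inE /= => xy ->.
apply/exists_inP; exists x.
  by rewrite !inE; apply/existsP; exists (val y).
apply/exists_inP; exists y; last exact: (@adj_monitored (induced C)).
by rewrite !inE; apply/existsP; exists (val x); rewrite adj_sym.
Qed.

Definition meg (G : sgraph) : nat := ex_minn (meg_set_ex G).

(* Main.v *)
Require Import Defs.
From mathcomp Require Import all_boot.

(** A leaf of any graph lies in every MEG-set, because it cannot be an interior
    vertex of a shortest path. In a forest the leaves do form a MEG-set: extend
    both ends of an edge [uv] to leaves [x] and [y]; since [uv] is a bridge,
    every walk from [x] to [y] uses it. Hence [meg] is the number of leaves of a
    forest, and a leaf created by deleting [F] is an end of an edge of [F]. *)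

Set Implicit Arguments.
Unset Strict Implicit.
Unset Printing Implicit Defensive.

Definition leaves (G : sgraph) : {set G} :=
  [set x | #|[set y | adj x y]| == 1].

Lemma leavesP (G : sgraph) (x : G) :
  reflect (exists2 v, adj x v & forall z, adj x z -> z = v) (x \in leaves G).
Proof.
rewrite inE; apply: (iffP cards1P) => [[v Nx]|[v xv Nx]]; exists v.
- by have /setP/(_ v) := Nx; rewrite !inE eqxx.
- by move=> z xz; apply/set1P; rewrite -Nx inE.
- by apply/setP => z; rewrite !inE; apply/idP/eqP => [/Nx|->].
Qed.

(** * Walks, shortest walks, and leaves as forced members *)

Lemma walk_edges_cons (G : sgraph) (x y : G) (p : seq G) :
  walk_edges x (y :: p) = [set x; y] :: walk_edges y p.
Proof. by []. Qed.

Lemma mem_walk_edges (G : sgraph) (x z : G) (p : seq G) (e : {set G}) :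
  e \in walk_edges x p -> z \in e -> z \in x :: p.
Proof.
elim: p x => [|y p IHp] x //; rewrite walk_edges_cons inE => /orP[/eqP->|ep ze].
  by rewrite !inE orbA => ->.
by rewrite inE IHp ?orbT.
Qed.

Lemma path_del_edges (G : sgraph) (F : {set {set G}}) (x : G) (p : seq G) :
  path (@adj (del_edges F)) x p =
  path (@adj G) x p && all [predC F] (walk_edges x p).
Proof.
elim: p x => [|y p IHp] x //.
by rewrite walk_edges_cons /= IHp /= andbACA.
Qed.

(** Removing the loops of a walk of minimal length cannot make it shorter, so some shortest walk is
    duplicate-free and has length exactly [dist x y]. *)
Lemma uniq_shortest_walk (G : sgraph) (x y : G) :
  connect (@adj G) x y ->
  exists2 p : (dist x y).-tuple G, walk x y p & uniq (x :: p).
Proof.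
move=> /connectP[q0 xq0 ->].
case: (shortenP xq0) => q xq uq _ {q0 xq0}.
set y' := last x q.
pose a n := [exists p : n.-tuple G, walk x y' p].
have walk_a (p : seq G) : walk x y' p -> a (size p).
  by move=> w; apply/existsP; exists (in_tuple p).
(* A duplicate-free path has fewer than [#|G|] edges, so the search over [iota 0 #|G|] succeeds and
   [dist] is not its default value. *)
have lt_q : size q < #|G| by have /card_uniqP /= <- := uq; exact: max_card.
have has_a : has a (iota 0 #|G|).
  apply/hasP; exists (size q); first by rewrite mem_iota.
  by apply: walk_a; rewrite /walk xq eqxx.
have ltd : dist x y' < #|G| by rewrite -[X in _ < X](size_iota 0) -has_find.
have := nth_find 0 has_a; rewrite -/(dist x y') nth_iota // add0n.
case/existsP => p /andP[xp /eqP lp].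
case: (shortenP xp) lp (size_tuple p) => r xr ur sub_rp lr sp.
have wr : walk x y' r by rewrite /walk xr lr eqxx.
have le_rd : size r <= dist x y'.
  rewrite -sp; apply: uniq_leq_size; first by case/andP: ur.
  by move=> z /sub_rp.
have sr : size r == dist x y'.
  rewrite eqn_leq le_rd leqNgt; apply/negP => lt_rd.
  have := before_find 0 lt_rd; rewrite nth_iota ?add0n; last exact: ltn_trans ltd.
  by move=> aF; have := walk_a r wr; rewrite /a aF.
by exists (Tuple sr).
Qed.

(** Take a pair of [M] that monitors the only edge at [l]. A duplicate-free shortest walk between
    them meets [l], and can do so only at one of its ends. *)
Lemma leaf_connected_meg_set (G : sgraph) (M : {set G}) (l : G) :
  (forall x y : G, connect (@adj G) x y) ->
  connected_meg_set M -> l \in leaves G -> l \in M.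
Proof.
move=> conG /forall_inP megM /leavesP[v lv Nl].
have /megM/exists_inP[x xM /exists_inP[y yM]] : [set l; v] \in edges G.
  by apply/imsetP; exists (l, v); rewrite ?inE.
have [p /andP[xp /eqP lp] up] := uniq_shortest_walk (conG x y).
move=> /forallP/(_ p); rewrite /walk xp lp eqxx /= => ep.
have [<- //|nlx] := eqVneq x l; have [<- //|nly] := eqVneq y l.
have: l \in x :: p by apply: mem_walk_edges ep _; rewrite set21.
rewrite inE eq_sym (negPf nlx) /= => lp'.
case/splitPr: lp' xp lp up => p1 [|z p2].
  by rewrite last_cat /= => _ E; rewrite E eqxx in nly.
(* If [l] is interior, the vertices just before and just after it are both its unique neighbour [v],
   a repetition. *)
rewrite cat_path => /andP[_ /and3P[p1l lz _]] _.
rewrite -cat_cons cat_uniq => /and3P[_ /hasPn/(_ z) + _].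
rewrite !inE eqxx orbT => /(_ isT) /negP; case.
by rewrite (Nl _ lz) -(Nl (last x p1)) -?in_cons ?mem_last // adj_sym.
Qed.

(** * From components to the whole graph *)

Section Component.
Variables (G : sgraph) (C : {set G}).
Hypothesis CG : C \in components G.

Lemma component_adj (x y : G) : x \in C -> adj x y -> y \in C.
Proof.
case/imsetP: CG => z _ ->; rewrite !inE => zx /connect1; exact: connect_trans.
Qed.

(** A path of [G] that starts in [C] never leaves it, so it lifts to the induced subgraph. *)
Lemma connect_component (x y : induced C) : connect (@adj (induced C)) x y.
Proof.
have: connect (@adj G) (val x) (val y).
  case/imsetP: CG => z _ defC.
  have inC w : (w \in C) = connect (@adj G) z w by rewrite defC inE.
  have := valP x; have := valP y; rewrite /= !inC => zy zx.
  by apply: connect_trans zy; rewrite (sym_connect_sym (@adj_sym G)).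
case/connectP=> p; elim: p x => [|z p IHp] x /=.
  by move=> _ /val_inj->.
case/andP=> xz zp lp.
have zC : z \in C := component_adj (valP x) xz.
have xz' : @adj (induced C) x (Sub z zC) by [].
apply: connect_trans (connect1 xz') _; exact: IHp.
Qed.

(** All neighbours of a vertex of [C] are in [C], so degrees are preserved. *)
Lemma leaves_component (x : induced C) :
  (val x \in leaves G) = (x \in leaves (induced C)).
Proof.
apply/leavesP/leavesP => -[v xv Nx].
  exists (Sub v (component_adj (valP x) xv)) => // z xz.
  by apply: val_inj; exact: Nx.
exists (val v) => // z xz.
by rewrite -(Nx (Sub z (component_adj (valP x) xz))).
Qed.

End Component.

Lemma leaves_sub_meg_set (G : sgraph) (M : {set G}) :
  meg_set M -> leaves G \subset M.
Proof.
move=> /forall_inP megM; apply/subsetP => l leaf_l.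
pose C := [set y | connect (@adj G) l y].
have CG : C \in components G by apply/imsetP; exists l.
have lC : l \in C by rewrite inE connect0.
have := megM C CG; case: ifP => [/cards1P[z Cz]|_ megC].
  have /leavesP[v lv _] := leaf_l.
  have := component_adj CG lC lv; move: lC; rewrite Cz => /set1P<- /set1P vl.
  by rewrite vl adj_irrefl in lv.
pose l' : induced C := Sub l lC.
have := leaf_connected_meg_set (connect_component CG) megC (l := l').
by rewrite -leaves_component // => /(_ leaf_l); rewrite inE.
Qed.

(** * Forests: leaves beyond an edge, and bridges *)

Lemma acyclic_del_edges (G : sgraph) (F : {set {set G}}) :
  acyclic G -> acyclic (del_edges F).
Proof.
move=> acG c /andP[cc uc]; apply: (acG c); rewrite /ucycle uc andbT.
by apply: sub_cycle cc => x y /andP[].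
Qed.

Lemma acyclic_induced (G : sgraph) (C : {set G}) :
  acyclic G -> acyclic (induced C).
Proof.
move=> acG c /andP[cc uc]; rewrite -(size_map val); apply: acG.
by rewrite /ucycle (map_inj_uniq val_inj) uc cycle_map cc.
Qed.

(** As long as the last vertex is not a leaf, it has a neighbour other than its predecessor. By
    acyclicity that neighbour is new, so the path grows, which must stop. A nonempty [p] provides
    the predecessor. *)
Lemma extend_to_leaf (G : sgraph) (v : G) (p : seq G) :
  acyclic G -> path (@adj G) v p -> uniq (v :: p) -> p != [::] ->
  exists q, [/\ path (@adj G) v (p ++ q), uniq (v :: p ++ q)
              & last v (p ++ q) \in leaves G].
Proof.
move=> acG; have [n] := ubnP (#|G| - size p); elim: n p => // n IHn p lt_pn vp up.
case/lastP: p lt_pn vp up => // p x lt_pn vpx upx _.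
have [leaf_x|nleaf_x] := boolP (x \in leaves G).
  by exists [::]; rewrite cats0 last_rcons.
have xw : adj x (last v p).
  by move: vpx; rewrite rcons_path adj_sym => /andP[].
have [z /andP[xz zw]] : exists z, adj x z && (z != last v p).
  apply/existsP; apply: contraNT nleaf_x => /existsPn Nx.
  apply/leavesP; exists (last v p) => // z xz.
  by apply/eqP; have := Nx z; rewrite xz negbK.
have [zp|zp] := boolP (z \in v :: rcons p x); last first.
  have vpz : path (@adj G) v (rcons (rcons p x) z).
    by rewrite rcons_path last_rcons vpx.
  have upz : uniq (v :: rcons (rcons p x) z) by rewrite -rcons_cons rcons_uniq zp.
  (* This makes the truncated difference [#|G| - size p] strictly decrease. *)
  have lt_card : size (rcons p x) < #|G|.
    by have /card_uniqP /= <- := upx; exact: max_card.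
  have [||q] := IHn _ _ vpz upz; last by exists (z :: q); rewrite -cat_rcons.
    rewrite size_rcons; apply: leq_trans (lt_pn : _ <= n).
    by rewrite ltn_sub2l.
  by rewrite -size_eq0 size_rcons.
have: z \in v :: p.
  move: zp; rewrite -rcons_cons mem_rcons inE => /orP[/eqP zx|//].
  by rewrite zx adj_irrefl in xz.
move=> zvp; exfalso.
have [s1 [s2 def_vp]] : exists s1 s2, v :: p = s1 ++ z :: s2.
  by case/splitPr: zvp => s1 s2; exists s1, s2.
(* Since [z] is not the predecessor of [x], some vertex lies between them, so the cycle closed by
   the edge [xz] has at least three vertices. *)
have s2_n0 : s2 != [::].
  apply: contraNneq zw => s20.
  by rewrite -[last v p]/(last z (v :: p)) def_vp s20 last_cat.
have sorted_c : sorted (@adj G) (s1 ++ z :: rcons s2 x).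
  by rewrite -rcons_cons -rcons_cat -def_vp.
have uniq_c : uniq (s1 ++ z :: rcons s2 x).
  by rewrite -rcons_cons -rcons_cat -def_vp.
have cyc : ucycle (@adj G) (z :: rcons s2 x).
  rewrite /ucycle; move: uniq_c; rewrite cat_uniq => /and3P[_ _ ->].
  rewrite andbT /= rcons_path last_rcons xz andbT.
  by have := drop_sorted (size s1) sorted_c; rewrite drop_size_cat.
have := acG _ cyc; rewrite /= size_rcons.
by case: (s2) s2_n0.
Qed.

Lemma acyclic_bridge (G : sgraph) (u v : G) :
  acyclic G -> adj u v ->
  ~~ connect (@adj (del_edges [set [set u; v]])) u v.
Proof.
move=> acG uv; apply/negP => /connectP[p0 up0 lv].
case: (shortenP up0) lv => p up unip _ lv {p0 up0}.
move: up; rewrite path_del_edges => /andP[up eF].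
have cyc : ucycle (@adj G) (u :: p).
  by rewrite /ucycle unip /= rcons_path up -lv adj_sym uv.
have := acG _ cyc.
(* Only two cases fit the bound: an empty [p] gives [u = v], and a single step is the deleted edge
   itself. *)
case: p eF lv {up unip cyc} => [|w [|w' p]] //= eF lv _.
  by rewrite lv adj_irrefl in uv.
by move: eF; rewrite -lv /= !inE eqxx.
Qed.

(** Extend the one-edge path from [v] to [u] up to a leaf: the part after [u] never returns to [v],
    so it avoids the edge [uv]. *)
Lemma leaf_beyond (G : sgraph) (u v : G) :
  acyclic G -> adj u v ->
  exists2 x, x \in leaves G & connect (@adj (del_edges [set [set u; v]])) u x.
Proof.
move=> acG uv.
have nvu : v != u by apply: contraTneq uv => ->; rewrite adj_irrefl.
have [|||q] := @extend_to_leaf G v [:: u] acG; rewrite /= ?mem_seq1 ?andbT //.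
  by rewrite adj_sym.
case=> /andP[_ uq] /andP[vuq _] leaf_x.
exists (last u q) => //; apply/connectP; exists q => //.
rewrite path_del_edges uq; apply/allP => e eq /=; rewrite inE.
apply: contra vuq => /eqP e_uv.
by apply: mem_walk_edges eq _; rewrite e_uv set22.
Qed.

Lemma connected_meg_set_leaves (G : sgraph) :
  acyclic G -> connected_meg_set (leaves G).
Proof.
move=> acG; apply/forall_inP => e /imsetP[[u v]]; rewrite inE /= => uv ->.
have [x leaf_x ux] := leaf_beyond acG uv.
have [y leaf_y] : exists2 y, y \in leaves G
    & connect (@adj (del_edges [set [set u; v]])) v y.
  by rewrite setUC; apply: leaf_beyond; rewrite // adj_sym.
rewrite (sym_connect_sym (@adj_sym (del_edges _))) => yv.
apply/exists_inP; exists x => //; apply/exists_inP; exists y => //.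
apply/forallP => p; apply/implyP => /andP[xp /eqP lp].
(* A walk from [x] to [y] missing [uv] would connect [u] to [v] through [x] and [y] without that
   edge. *)
apply: contraNT (acyclic_bridge acG uv) => e_p.
apply: connect_trans ux (connect_trans _ yv).
apply/connectP; exists p => //; rewrite path_del_edges xp.
by apply/allP => f fp /=; rewrite inE; apply: contraNneq e_p => <-.
Qed.

Lemma meg_set_leaves (G : sgraph) : acyclic G -> meg_set (leaves G).
Proof.
move=> acG; apply/forall_inP => C CG; case: ifP => [/cards1P[z Cz]|_].
  apply/eqP/setP => x; rewrite in_set0 in_setI; apply/negP => /andP[].
  move=> /leavesP[v xv _] xC; have := component_adj CG xC xv.
  by move: xC; rewrite Cz => /set1P xz /set1P vz; rewrite xz vz adj_irrefl in xv.
have -> : [set x | val x \in leaves G] = leaves (induced C).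
  by apply/setP => x; rewrite in_set leaves_component.
exact: connected_meg_set_leaves (acyclic_induced acG).
Qed.

(** * Counting the leaves after deletion *)

Lemma leaves_del_edges (G : sgraph) (F : {set {set G}}) :
  leaves (del_edges F) \subset leaves G :|: cover F.
Proof.
apply/subsetP => x leaf_x; rewrite in_setU orbC -implyNb.
apply/implyP => nFx.
(* A vertex on no edge of [F] keeps its whole neighbourhood. *)
have adjE : @adj (del_edges F) x =1 @adj G x.
  move=> y /=; apply: andb_idr => _; apply: contra nFx => Fxy.
  by apply/bigcupP; exists [set x; y]; rewrite ?set21.
case/leavesP: leaf_x => v xv Nx.
by apply/(@leavesP G x); exists v => [|z]; rewrite -adjE //; exact: Nx.
Qed.

Lemma card_cover_edges (G : sgraph) (F : {set {set G}}) :
  F \subset edges G -> #|cover F| <= 2 * #|F|.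
Proof.
move=> /subsetP FE; apply: leq_trans (leq_card_cover F) _.
rewrite mulnC -sum_nat_const; apply: leq_sum => e /FE /imsetP[z _ ->].
by rewrite cards2; case: eqP.
Qed.

Lemma meg_leq (G : sgraph) (M : {set G}) : meg_set M -> meg G <= #|M|.
Proof.
rewrite /meg => megM; case: ex_minnP => n _; apply.
by apply/existsP; exists M; rewrite megM eqxx.
Qed.

Lemma leq_leaves_meg (G : sgraph) : #|leaves G| <= meg G.
Proof.
rewrite /meg; case: ex_minnP => n /existsP[M /andP[megM /eqP<-]] _.
exact/subset_leq_card/leaves_sub_meg_set.
Qed.

Theorem theorem3p4 (G : sgraph) (k : nat) (F : {set {set G}}) :
  is_tree G -> F \subset edges G -> #|F| <= k ->
  0 <= meg (del_edges F) <= meg G + 2 * k.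
Proof.
move=> [_ acG] FE Fk; rewrite leq0n.
have acF := @acyclic_del_edges G F acG.
apply: leq_trans (meg_leq (meg_set_leaves acF)) _.
apply: leq_trans (subset_leq_card (leaves_del_edges F)) _.
apply: leq_trans (leq_card_setU _ _) (leq_add (leq_leaves_meg G) _).
by apply: leq_trans (card_cover_edges FE) _; rewrite leq_mul2l.
Qed.
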